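(* Let $\boldsymbol{S},\boldsymbol{J},\boldsymbol{R}\in\mathbb{R}^{n_z\times n_z}$ satisfy $\boldsymbol{S}=\boldsymbol{S}^{\top}\succ 0$, $\boldsymbol{J}^{\top}=-\boldsymbol{J}$, and $\boldsymbol{R}=\boldsymbol{R}^{\top}\succeq 0$. Set $\boldsymbol{A}_c=\boldsymbol{S}^{-1}(\boldsymbol{J}-\boldsymbol{R})$, let $\boldsymbol{B}_c\in\mathbb{R}^{n_z\times m}$ be the lifted input matrix defined in the context, and consider the lifted dynamics $\dot{\boldsymbol{z}}=\boldsymbol{A}_c\boldsymbol{z}+\boldsymbol{B}_c\boldsymbol{u}$ with state $\boldsymbol{z}(t)\in\mathbb{R}^{n_z}$ and input $\boldsymbol{u}(t)\in\mathbb{R}^m$. Define the storage function $\tilde{H}(\boldsymbol{z})=\tfrac12\boldsymbol{z}^{\top}\boldsymbol{S}\boldsymbol{z}$ and the output $\tilde{\boldsymbol{y}}=\boldsymbol{B}_c^{\top}\boldsymbol{S}\boldsymbol{z}$. Then, along every solution, $$\dot{\tilde{H}}=-\boldsymbol{z}^{\top}\boldsymbol{R}\boldsymbol{z}+\tilde{\boldsymbol{y}}^{\top}\boldsymbol{u}\le \tilde{\boldsymbol{y}}^{\top}\boldsymbol{u},$$ where $\dot{\tilde H}$ denotes the time derivative of $\tilde{H}(\boldsymbol{z}(t))$. Hence the lifted dynamics are dissipative with respect to the supply rate $\tilde{\boldsymbol{y}}^{\top}\boldsymbol{u}$ (with storage function $\tilde H$).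
   Context: All matrices are real. The dimension is $n_z=2n_q+n_\phi$, where $n_q$ is the number of generalized coordinates of a mechanical system and $n_\phi$ is the number of additional lifting functions. The lifted input matrix is $$\boldsymbol{B}_c=\begin{bmatrix}\boldsymbol{0}_{n_q\times m}\\ \boldsymbol{S}_a\\ \boldsymbol{0}_{n_\phi\times m}\end{bmatrix}\in\mathbb{R}^{n_z\times m},$$ where $\boldsymbol{S}_a\in\mathbb{R}^{n_q\times m}$ is a given constant matrix (the generalized-force distribution matrix). $\succ 0$ and $\succeq 0$ mean positive definite and positive semidefinite. A system is dissipative with respect to a supply rate $s$ with storage function $\tilde H\geq 0$ if $\dot{\tilde H}\le s$ along all trajectories. *)

(* Defs.v *)
From mathcomp Require Import all_boot all_order all_algebra.
From mathcomp Require Import all_classical all_reals all_analysis.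
From mathcomp Require Import ring lra.

Set Implicit Arguments.
Unset Strict Implicit.
Unset Printing Implicit Defensive.

Import Order.TTheory GRing.Theory Num.Theory.
Import numFieldNormedType.Exports.

Local Open Scope classical_set_scope.
Local Open Scope ring_scope.

Section Matrices.
Variable K : realType.

Definition dotv n (x y : 'cV[K]_n) : K := (x^T *m y) 0 0.

Definition quad n (M : 'M[K]_n) (x : 'cV[K]_n) : K := (x^T *m M *m x) 0 0.

Definition posdef n (M : 'M[K]_n) : Prop :=
  forall x : 'cV[K]_n, x != 0 -> 0 < quad M x.

Definition possemidef n (M : 'M[K]_n) : Prop :=
  forall x : 'cV[K]_n, 0 <= quad M x.

(* The state dimension 2 n_q + n_phi is written n_q + n_q + n_phi, so that the
   three blocks stack without a cast. *)
Definition lifted_input nq nphi m (Sa : 'M[K]_(nq, m)) :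
    'M[K]_(nq + nq + nphi, m) :=
  col_mx (col_mx (0 : 'M[K]_(nq, m)) Sa) (0 : 'M[K]_(nphi, m)).

End Matrices.

Section Dynamics.
Variable K : realType.

(* f has derivative l at t relative to the set D: the usual derivative when t
   is interior to D (has_derivative_inP below), the one-sided derivative when
   D is an interval and t is one of its endpoints. *)
Definition has_derivative_in (V : normedModType K) (D : set K) (f : K -> V)
    (t : K) (l : V) : Prop :=
  (s - t)^-1 *: (f s - f t) @[s --> within D t^'] --> l.

Definition nontrivial_interval (I : interval K) : Prop :=
  exists a b : K, [/\ a \in I, b \in I & a < b].

(* No regularity of the input u is required. *)
Definition is_solution n m (F : 'cV[K]_n -> 'cV[K]_m -> 'cV[K]_n)
    (I : interval K) (u : K -> 'cV[K]_m) (z : K -> 'cV[K]_n) : Prop :=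
  forall t, t \in I -> has_derivative_in [set` I] z t (F (z t) (u t)).

(* Dissipativity of z' = F z u, y = G z with respect to the supply rate
   s y u, with storage function H.  The derivative d of H along the solution
   is unique because the time interval is not reduced to a point
   (has_derivative_in_unique below). *)
Definition dissipative n m p (F : 'cV[K]_n -> 'cV[K]_m -> 'cV[K]_n)
    (G : 'cV[K]_n -> 'cV[K]_p) (s : 'cV[K]_p -> 'cV[K]_m -> K)
    (H : 'cV[K]_n -> K) : Prop :=
  (forall z, 0 <= H z) /\
  forall (I : interval K) (u : K -> 'cV[K]_m) (z : K -> 'cV[K]_n),
    nontrivial_interval I -> is_solution F I u z ->
    forall t, t \in I ->
      exists2 d : K, has_derivative_in [set` I] (fun r => H (z r) : K^o) t d
                   & d <= s (G (z t)) (u t).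

Lemma has_derivative_inP (V : normedModType K) (D : set K) (f : K -> V)
    (t : K) (l : V) :
  nbhs t D -> has_derivative_in D f t l <-> is_derive (t : K^o) 1 f l.
Proof.
move=> Dt.
have -> : has_derivative_in D f t l =
    ((s - t)^-1 *: (f s - f t) @[s --> t^'] --> l).
  rewrite /has_derivative_in (_ : within D t^' = t^') //.
  apply/seteqP; split=> A; rewrite /within /= => hA; last first.
    by apply: filterS hA.
  have Dt' : t^' D by apply: nbhs_dnbhs.
  by apply: filterS2 hA Dt' => x Ax Dx; exact: Ax.
have -> : ((s - t)^-1 *: (f s - f t) @[s --> t^']) =
    ((fun h => h^-1 *: ((f \o shift t) (h *: (1 : K^o)) - f t)) @ 0^').
  have shiftE (A : set K) : t^' A <-> 0^' (fun h => A (h + t)).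
    split=> /nbhs_ballP[e e0 Ae]; apply/nbhs_ballP; exists e => //= x xe xn.
      apply: Ae; last by rewrite /= -subr_eq0 addrK.
      by move: xe; rewrite /ball /= sub0r normrN opprD addrCA subrr addr0 normrN.
    have -> : x = (x - t) + t by rewrite subrK.
    apply: Ae; last by rewrite /= subr_eq0.
    by move: xe; rewrite /ball /= sub0r normrN distrC.
  have E h : (h + t - t)^-1 *: (f (h + t) - f t) =
             h^-1 *: ((f \o shift t) (h *: (1 : K^o)) - f t).
    by rewrite addrK /= [h *: _]mulr1.
  apply/seteqP; split=> A.
    by move=> /shiftE; apply: filterS => h /=; rewrite E.
  by move=> hA; apply/shiftE; apply: (@filterS _ (0 : K)^' _ _ _ _ hA) => h /=; rewrite E.
split=> [h|[dvf <-]]; last exact: dvf.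
by split; [apply/cvg_ex; exists l|apply: cvg_lim].
Qed.

Lemma has_derivative_in_unique (V : normedModType K) (I : interval K)
    (f : K -> V) (t : K) (l1 l2 : V) :
  nontrivial_interval I -> t \in I ->
  has_derivative_in [set` I] f t l1 -> has_derivative_in [set` I] f t l2 ->
  l1 = l2.
Proof.
move=> [a [b [aI bI ab]]] tI.
have [c cI cNt] : exists2 c, c \in I & c != t.
  have [ta|] := eqVneq a t; last by exists a.
  by exists b => //; rewrite -ta gt_eqF.
have PF : ProperFilter (within [set` I] t^').
  apply: Build_ProperFilter_ex => A /nbhs_ballP[e e0 Ae].
  pose k := Num.min 1 (e / (2 * `|c - t|)).
  have ct0 : 0 < `|c - t| by rewrite normr_gt0 subr_eq0.
  have k0 : 0 < k by rewrite lt_min ltr01 divr_gt0 // mulr_gt0.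
  have k1 : k <= 1 by rewrite ge_min lexx.
  exists (t + k * (c - t)); apply: Ae => /=.
  - rewrite /ball /= opprD addrA subrr sub0r normrN normrM gtr0_norm //.
    have : k * `|c - t| <= e / 2.
      rewrite -ler_pdivlMr // -mulrA -invfM ge_min; apply/orP; right.
      by rewrite lexx.
    move/le_lt_trans; apply; rewrite ltr_pdivrMr // mulr_natr mulr2n.
    by rewrite ltrDl.
  - by rewrite -subr_eq0 addrAC subrr add0r mulf_neq0 ?subr_eq0 // gt_eqF.
  have := @interval_is_interval _ I.
  have [ct|tc|ctE] := ltgtP c t; last by rewrite ctE eqxx in cNt.
    move=> /(_ c t cI tI); apply.
    by apply/andP; split; nra.
  move=> /(_ t c tI cI); apply.
  by apply/andP; split; nra.
exact: cvg_unique.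
Qed.

End Dynamics.

(* Main.v *)
Require Import Defs.
From mathcomp Require Import all_boot all_order all_algebra.
From mathcomp Require Import all_classical all_reals all_analysis.
From mathcomp Require Import ring.

Set Implicit Arguments.
Unset Strict Implicit.
Unset Printing Implicit Defensive.

Import Order.TTheory GRing.Theory Num.Theory.
Import numFieldNormedType.Exports.

Local Open Scope classical_set_scope.
Local Open Scope ring_scope.

(* Expanding the quadratic storage function around [z t] writes its difference
    quotient as [(z t)^T S q + (s - t) / 2 * q^T S q], where [q] is the
    difference quotient of [z]; it therefore tends to [z^T S z'].  Along the
    dynamics [S z' = (J - R) z + S B u], and [z^T J z = 0] since [J] is skew. *)

Lemma mx11_tr (K : realType) (M : 'M[K]_1) : M 0 0 = M^T 0 0.
Proof. by rewrite mxE. Qed.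

(** Transposing the scalar [x^T J x] leaves it unchanged but replaces [J] by [- J], so it equals its
    own opposite. *)
Lemma quad_skew (K : realType) n (J : 'M[K]_n) (x : 'cV[K]_n) :
  J^T = - J -> quad J x = 0.
Proof.
move=> JN; have : quad J x = - quad J x.
  by rewrite {1}/quad mx11_tr !trmx_mul trmxK JN mulNmx mulmxN mulmxA mxE.
by move=> /eqP; rewrite -addr_eq0 -mulr2n mulrn_eq0 => /eqP.
Qed.

Lemma quadDl (K : realType) n (A B : 'M[K]_n) (x : 'cV[K]_n) :
  quad (A + B) x = quad A x + quad B x.
Proof. by rewrite /quad mulmxDr mulmxDl mxE. Qed.

Lemma quadNl (K : realType) n (A : 'M[K]_n) (x : 'cV[K]_n) :
  quad (- A) x = - quad A x.
Proof. by rewrite /quad mulmxN mulNmx mxE. Qed.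

Lemma quadZr (K : realType) n (M : 'M[K]_n) (a : K) (x : 'cV[K]_n) :
  quad M (a *: x) = a * (a * quad M x).
Proof. by rewrite /quad -scalemxAr mxE linearZ /= -!scalemxAl; congr (_ * _); rewrite mxE. Qed.

Lemma dotvZr (K : realType) n (a : K) (x y : 'cV[K]_n) :
  dotv x (a *: y) = a * dotv x y.
Proof. by rewrite /dotv -scalemxAr mxE. Qed.

(** Exact second-order expansion at [y] with increment [d = x - y]: symmetry merges the cross terms
    [d^T S y] and [y^T S d]. *)
Lemma quadB (K : realType) n (S : 'M[K]_n) (x y : 'cV[K]_n) : S^T = S ->
  quad S x - quad S y = 2 * dotv (S *m y) (x - y) + quad S (x - y).
Proof.
move=> Ssym; have [d ->] : exists d, x = y + d by
  exists (x - y); rewrite addrC subrK.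
rewrite (addrC y) addrK.
have Edy : (d^T *m S *m y) 0 0 = (y^T *m S *m d) 0 0.
  by rewrite mx11_tr !trmx_mul trmxK Ssym mulmxA.
rewrite /quad /dotv trmx_mul Ssym [(d + y)^T]linearD /= !mulmxDl !mulmxDr.
have mxDE (M N : 'M[K]_1) : (M + N) 0 0 = M 0 0 + N 0 0 by rewrite mxE.
rewrite !mxDE Edy; ring.
Qed.

(** A nonzero row [v] with [v S = 0] would give [v S v^T = 0], against positivity. *)
Lemma posdef_unitmx (K : realType) n (S : 'M[K]_n) :
  posdef S -> S \in unitmx.
Proof.
move=> Spos; rewrite -row_free_unit -kermx_eq0.
apply/rowV0P => v /sub_kermxP vS0; apply/eqP/negPn/negP => v0.
have /Spos : v^T != 0 by rewrite trmx_eq0.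
by rewrite /quad trmxK vS0 mul0mx mxE ltxx.
Qed.

Lemma cvg_coord (K : realType) (T : Type) (F : set_system T) (FF : Filter F)
    n (f : T -> 'cV[K]_n) (a : 'cV[K]_n) i j :
  f @ F --> a -> (f s i j) @[s --> F] --> a i j.
Proof.
move=> fa; apply: (cvg_comp f (fun M : 'cV[K]_n => M i j) fa).
exact: coord_continuous.
Qed.

Lemma cvg_dotvr (K : realType) (T : Type) (F : set_system T) (FF : Filter F)
    n (b : 'cV[K]_n) (f : T -> 'cV[K]_n) (a : 'cV[K]_n) :
  f @ F --> a -> dotv b (f s) @[s --> F] --> dotv b a.
Proof.
move=> fa; rewrite /dotv mxE; under eq_fun do rewrite mxE.
apply: cvg_big => [|i _]; first exact: add_continuous.
apply: cvgM; [exact: cvg_cst|exact: cvg_coord].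
Qed.

Lemma cvg_quad (K : realType) (T : Type) (F : set_system T) (FF : Filter F)
    n (M : 'M[K]_n) (f : T -> 'cV[K]_n) (a : 'cV[K]_n) :
  f @ F --> a -> quad M (f s) @[s --> F] --> quad M a.
Proof.
move=> fa; rewrite /quad mxE; under eq_fun do rewrite mxE.
apply: cvg_big => [|i _]; first exact: add_continuous.
apply: cvgM; last exact: cvg_coord.
(* The remaining factor is an entry of [x^T M], itself a finite sum of coordinates times
   constants. *)
rewrite mxE; under eq_fun do rewrite mxE.
apply: cvg_big => [|j _]; first exact: add_continuous.
apply: cvgM; last exact: cvg_cst.
by rewrite mxE; under eq_fun do rewrite mxE; exact: cvg_coord.
Qed.

Lemma has_derivative_in_quad (K : realType) n (S : 'M[K]_n) (D : set K)
    (z : K -> 'cV[K]_n) (t : K) (l : 'cV[K]_n) : S^T = S ->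
  has_derivative_in D z t l ->
  has_derivative_in D (fun r => 2^-1 * quad S (z r) : K^o) t
    (dotv (S *m z t) l).
Proof.
move=> Ssym zl; rewrite /has_derivative_in.
pose q s := (s - t)^-1 *: (z s - z t).
have -> : (fun s => (s - t)^-1 *:
             ((2^-1 * quad S (z s) : K^o) - 2^-1 * quad S (z t))) =
    (fun s => dotv (S *m z t) (q s) + (s - t) * (2^-1 * quad S (q s))).
  apply/funext => s; rewrite dotvZr quadZr -mulrBr quadB // /GRing.scale /=.
  (* The two functions agree even at [s = t], where the convention [0^-1 = 0] makes both sides
     vanish. *)
  have [->|st] := eqVneq s t; first by rewrite !subrr invr0 !mul0r addr0.
  by field; rewrite subr_eq0.
(* The limit is put in the shape of the quotient: the second term tends to [0] times the finite
   limit of [2^-1 * quad S (q s)]. *)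
rewrite -[X in _ --> X]addr0 -[X in _ + X](mul0r (2^-1 * quad S l)).
apply: cvgD; first exact: cvg_dotvr.
apply: cvgM; last by apply: cvgM; [exact: cvg_cst|exact: cvg_quad].
have st0 : s - t @[s --> t] --> (0 : K).
  by rewrite -(subrr t); apply: cvgB; [exact: cvg_id|exact: cvg_cst].
(* Two restrictions of the neighbourhood filter: to [D], and to points other than [t]. *)
by do 2 apply: cvg_within_filter.
Qed.

Lemma power_balance (K : realType) n m (S J R : 'M[K]_n) (B : 'M[K]_(n, m))
    (z : 'cV[K]_n) (u : 'cV[K]_m) :
  S^T = S -> S \in unitmx -> J^T = - J ->
  dotv (S *m z) (invmx S *m (J - R) *m z + B *m u) =
  - quad R z + dotv (B^T *m S *m z) u.
Proof.
(* Adding [z^T J z = 0] turns the dissipated power into [quad (J - R) z]; then [(S z)^T S^-1 = z^T]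
   by symmetry of [S]. *)
move=> Ssym Su JN; rewrite -quadNl -[quad (- R) z]add0r -(quad_skew z JN) -quadDl.
rewrite /dotv /quad !trmx_mul trmxK Ssym mulmxDr mxE.
by rewrite !mulmxA mulmxK.
Qed.

Theorem mainTheorem1 (K : realType) (nq nphi m : nat) (Sa : 'M[K]_(nq, m))
    (S J R : 'M[K]_(nq + nq + nphi))
    (S_sym : S^T = S) (S_posdef : posdef S)
    (J_skew : J^T = - J)
    (R_sym : R^T = R) (R_possemidef : possemidef R) :
  let Ac := invmx S *m (J - R) in
  let Bc := lifted_input nphi Sa in
  let dynamics (z : 'cV[K]_(nq + nq + nphi)) (u : 'cV[K]_m) :=
    Ac *m z + Bc *m u in
  let H (z : 'cV[K]_(nq + nq + nphi)) := 2^-1 * quad S z in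
  let output (z : 'cV[K]_(nq + nq + nphi)) := Bc^T *m S *m z in
  (forall (I : interval K) (u : K -> 'cV[K]_m)
      (z : K -> 'cV[K]_(nq + nq + nphi)),
     nontrivial_interval I -> is_solution dynamics I u z ->
     forall t, t \in I ->
       has_derivative_in [set` I] (fun r => H (z r) : K^o) t
         (- quad R (z t) + dotv (output (z t)) (u t)) /\
       - quad R (z t) + dotv (output (z t)) (u t)
         <= dotv (output (z t)) (u t)) /\
  dissipative dynamics output (fun y u => dotv y u) H.
Proof.
move=> Ac Bc dynamics H output.
have balance (I : interval K) (u : K -> 'cV[K]_m)
    (z : K -> 'cV[K]_(nq + nq + nphi)) :
    is_solution dynamics I u z -> forall t, t \in I ->
    has_derivative_in [set` I] (fun r => H (z r) : K^o) t
      (- quad R (z t) + dotv (output (z t)) (u t)).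
  (* Read backwards, the power balance restores the pairing of [S z] with the velocity, the form in
     which the derivative of [H] is known. *)
  move=> zsol t tI; rewrite /output -(power_balance _ _ _ _ S_sym _ J_skew).
    by apply: has_derivative_in_quad => //; exact: zsol.
  exact: posdef_unitmx.
have supply z u : - quad R z + dotv (output z) u <= dotv (output z) u.
  by rewrite gerDr oppr_le0.
split; first by move=> I u z _ zsol t tI; split; [exact: balance|].
split=> [z|I u z _ zsol t tI].
  (* Positive definiteness speaks only of nonzero vectors, so [z = 0] is treated apart. *)
  rewrite mulr_ge0 ?invr_ge0 //; have [->|/S_posdef/ltW//] := eqVneq z 0.
  by rewrite /quad mulmx0 mxE.
by exists (- quad R (z t) + dotv (output (z t)) (u t)); [exact: balance|].
Qed.
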